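(* Let $X$ be a Baire space and $Y$ a metric space with metric $\rho$. If a filter $\mathcal{F}$ on $\mathcal{M}(X,Y)$ converges to $f\in\mathcal{M}(X,Y)$, then there exists a residual subset $D$ of $X$ such that for every $x\in D$: (i) $f(x)$ is a singleton (identified with its element, a point of $Y$); (ii) the filter $\mathcal{F}(x)$ converges to $f(x)$ with respect to the metric $\rho$.
   Context: A set-valued map $g:X\to Y$ is usco if $g(x)$ is a nonempty compact subset of $Y$ for each $x\in X$ and $\{x\in X: g(x)\subset U\}$ is open in $X$ for each open $U\subset Y$. Set-valued maps are identified with their graphs, so $h\subset g$ means $h(x)\subset g(x)$ for all $x\in X$. A usco map $g$ is minimal if $h=g$ for every usco $h:X\to Y$ with $h\subset g$. $\mathcal{M}(X,Y)$ is the set of all minimal usco maps from $X$ to $Y$. For a usco map $g:X\to Y$, $[g]=\{f\in\mathcal{M}(X,Y): f\subset g\}$. A filter $\mathcal{F}$ on $\mathcal{M}(X,Y)$ converges to $f\in\mathcal{M}(X,Y)$ if $\{f\}=\bigcap\{[g]: g:X\to Y \text{ usco},\ [g]\in\mathcal{F}\}$ (in particular at least one usco $g$ with $[g]\in\mathcal{F}$ is required to exist). For $F\subset\mathcal{M}(X,Y)$ and $x\in X$ put $F(x)=\bigcup\{h(x):h\in F\}\subset Y$. For a filter $\mathcal{F}$ on $\mathcal{M}(X,Y)$ and $x\in X$, $\mathcal{F}(x)$ is the filter on $Y$ generated by the filter base $\{F(x):F\in\mathcal{F}\}$. No separation axioms are assumed on $X$. A residual set is one whose complement is of first category (meager). 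*)

(* Defs.v *)
From HB Require Import structures.
From mathcomp Require Import all_boot all_order all_algebra.
From mathcomp Require Import all_classical all_reals all_analysis.

Set Implicit Arguments.
Unset Strict Implicit.
Unset Printing Implicit Defensive.

Local Open Scope classical_set_scope.

Definition baire_space (X : topologicalType) : Prop :=
  forall U : nat -> set X,
    (forall n, open (U n) /\ dense (U n)) -> dense (\bigcap_n U n).

Definition nowhere_dense (X : topologicalType) (A : set X) : Prop :=
  interior (closure A) = set0.

Definition meager (X : topologicalType) (A : set X) : Prop :=
  exists N : nat -> set X,
    (forall n, nowhere_dense (N n)) /\ A = \bigcup_n N n.

Definition residual (X : topologicalType) (A : set X) : Prop :=
  meager (~` A).

Definition usco (X Y : topologicalType) (g : X -> set Y) : Prop :=
  (forall x, g x !=set0 /\ compact (g x)) /\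
  (forall U : set Y, open U -> open [set x | g x `<=` U]).

Definition map_subset (X Y : Type) (h g : X -> set Y) : Prop :=
  forall x, h x `<=` g x.

Definition minimal_usco (X Y : topologicalType) (g : X -> set Y) : Prop :=
  usco g /\ forall h : X -> set Y, usco h -> map_subset h g -> h = g.

(* The set M(X,Y) of minimal usco maps, as a type so that filters on M(X,Y) are
   library filters. *)
Definition min_usco (X Y : topologicalType) : Type :=
  {f : X -> set Y | minimal_usco f}.

(* Written [g] in the literature; used only for g usco. *)
Definition min_below (X Y : topologicalType) (g : X -> set Y) :
    set (min_usco X Y) :=
  [set f | map_subset (sval f) g].

(* The first conjunct matters: an intersection over an empty family is all of
   M(X,Y), which may itself be {f}. *)
Definition usco_cvg (X Y : topologicalType)
    (F : set_system (min_usco X Y)) (f : min_usco X Y) : Prop :=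
  let G := [set g : X -> set Y | usco g /\ F (min_below g)] in
  G !=set0 /\ [set f] = \bigcap_(g in G) min_below g.

Definition values_at (X Y : topologicalType) (A : set (min_usco X Y)) (x : X) :
    set Y :=
  \bigcup_(h in A) sval h x.

Definition filter_at (X Y : topologicalType)
    (F : set_system (min_usco X Y)) (x : X) : set_system Y :=
  filter_from F (fun A => values_at A x).

(* Main.v *)
(** Let [p x] be the intersection of the values [g x] over the usco maps [g]
    with [[g]] in the filter. This family of maps is down-directed, so by
    compactness [p] is usco and every open set containing [p x] contains some
    [g x]; hence the filter at [x] converges to [y] as soon as [p x] is the
    singleton [y]. Convergence to [f] says that [f] is the only minimal usco
    map below [p]. This forces the open set of the points [x] with [p x] inside
    some ball of radius [1/n] to be dense: if [p x] left the ball of a point of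
    [f x0] for every [x] in a neighbourhood of [x0], removing that ball from
    [p] there would leave a usco map, and a minimal usco map below it could not
    be [f]. *)

Require Import Defs.
From HB Require Import structures.
From mathcomp Require Import all_boot all_order all_algebra.
From mathcomp Require Import all_classical all_reals all_analysis.

Import Order.TTheory GRing.Theory Num.Theory.

Local Open Scope classical_set_scope.

(** If no [K] lies in [U], the sets K minus U are nonempty and generate a proper filter. It clusters
    in the compact [K0], and since these sets are closed the cluster point lies in every [K] but not
    in [U]. *)
Lemma directed_compact_bigcap_sub (T : topologicalType) (C : set (set T))
    (U : set T) :
  hausdorff_space T -> C !=set0 -> (forall K, C K -> compact K) ->
  (forall K L, C K -> C L -> exists2 M, C M & M `<=` K `&` L) ->
  open U -> \bigcap_(K in C) K `<=` U -> exists2 K, C K & K `<=` U.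
Proof.
move=> hT [K0 CK0] cC dC oU capU; apply: contrapT => nK.
have FF : ProperFilter (filter_from C (fun K => K `\` U)).
  apply: filter_from_proper.
    apply: filter_from_filter; first by exists K0.
    move=> K L CK CL; have [M CM MKL] := dC K L CK CL.
    by exists M => // t [/MKL[Kt Lt] nUt].
  move=> K CK; apply: contrapT => /set0P/negP/negPn/eqP; rewrite setD_eq0 => KU.
  by apply: nK; exists K.
have [|z [_ cz]] := cC _ CK0 _ FF; first by exists K0 => // t [].
have clz K : C K -> K z /\ ~ U z.
  move=> CK.
  have : closed (K `\` U).
    rewrite setDE; apply: closedI; last exact: open_closedC.
    exact: compact_closed (cC _ CK).
  apply=> B Bz; apply: cz => //; by exists K.
by have [_] := clz _ CK0; apply; apply: capU => K /clz[].
Qed.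

Section usco_maps.
Context {X Y : topologicalType}.
Implicit Types (g h : X -> set Y) (G : set (X -> set Y)).

Definition down_directed G := forall g h, G g -> G h ->
  exists2 k, G k & Defs.map_subset k g /\ Defs.map_subset k h.

Lemma usco_bigcap_sub G x (U : set Y) :
  hausdorff_space Y -> G !=set0 -> G `<=` @usco X Y -> down_directed G ->
  open U -> \bigcap_(g in G) g x `<=` U -> exists2 g, G g & g x `<=` U.
Proof.
move=> hY [g0 Gg0] uG dG oU capU.
have [||K L|||K] := @directed_compact_bigcap_sub _ [set g x | g in G] U hY.
- by exists (g0 x), g0.
- by move=> _ [g /uG[+ _] <-] => /(_ x)[].
- move=> [g Gg <-] [h Gh <-]; have [k Gk [kg kh]] := dG _ _ Gg Gh.
  by exists (k x); [exists k|move=> y ky; split; [exact: kg|exact: kh]].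
- exact: oU.
- by move=> y Cy; apply: capU => g Gg; apply: Cy; exists g.
- by case=> g Gg <- gU; exists g.
Qed.

Lemma usco_bigcap G :
  hausdorff_space Y -> G !=set0 -> G `<=` @usco X Y -> down_directed G ->
  usco (fun x => \bigcap_(g in G) g x).
Proof.
move=> hY G0 uG dG; split=> [x|U oU].
  split.
    (* An empty intersection would lie in [set0], and then so would some [g x], which is
       nonempty. *)
    apply: contrapT => /set0P/negP/negPn/eqP cap0.
    have [||g Gg] := @usco_bigcap_sub G x set0 hY G0 uG dG.
    - exact: open0.
    - by rewrite cap0.
    - by have [+ _] := uG _ Gg => /(_ x)[[y gy] _] /(_ _ gy).
  have [g Gg] := G0; have [/(_ x)[_ cg] _] := uG _ Gg.
  apply: (subclosed_compact _ cg); last by move=> y; exact.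
  apply: closed_bigI => h Gh.
  by have [/(_ x)[_ ch] _] := uG _ Gh; exact: compact_closed.
rewrite openE => x /= capU.
have [g Gg gU] := usco_bigcap_sub _ _ _ hY G0 uG dG oU capU.
have [_ /(_ _ oU)] := uG _ Gg.
rewrite openE => /(_ _ gU); apply: filterS => z /= gzU y; move/(_ _ Gg).
exact: gzU.
Qed.

Lemma minimal_usco_exists g : hausdorff_space Y -> usco g ->
  exists2 h, minimal_usco h & Defs.map_subset h g.
Proof.
move=> hY ug; pose P h := usco h /\ Defs.map_subset h g; pose T := sig P.
(* [R] is reverse inclusion, so that maximal elements are minimal maps. The empty chain is bounded
   by [g], since the intersection over it need not lie below [g]. *)
pose R (h k : T) := `[< Defs.map_subset (sval k) (sval h) >].
have [||||[h [uh hg]] hmin] := @Zorn T R.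
- by move=> h; apply/asboolP => x.
- move=> h k l /asboolP kh /asboolP lk; apply/asboolP => x.
  exact: subset_trans (lk x) (kh x).
- move=> [h ?] [k ?] /asboolP/= kh /asboolP/= hk; apply: eq_exist.
  by apply/funext => x; apply/seteqP.
- move=> A totA; have [[h0 Ah0]|A0] := pselect (A !=set0); last first.
    exists (exist P g (conj ug (fun x => @subset_refl _ (g x)))) => h Ah.
    by case: A0; exists h.
  pose G := [set sval h | h in A].
  have ucap : usco (fun x => \bigcap_(g in G) g x).
    apply: usco_bigcap => //; first by exists (sval h0), h0.
      by move=> _ [[h [? ?]] _ <-].
    move=> _ _ [h Ah <-] [k Ak <-].
    have [/asboolP kh|/asboolP hk] := totA _ _ Ah Ak.
      by exists (sval k); [exists k|split=> // x].
    by exists (sval h); [exists h|split=> // x].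
  have capg : Defs.map_subset (fun x => \bigcap_(g in G) g x) g.
    move=> x y cy; have [_ /(_ x)] := svalP h0; apply.
    by apply: cy; exists h0.
  exists (exist P _ (conj ucap capg)) => h Ah.
  by apply/asboolP => x y /= cy; apply: cy; exists h.
exists h => //; split=> // k uk kh.
have kg : Defs.map_subset k g by move=> x; exact: subset_trans (kh x) (hg x).
have := hmin (exist P k (conj uk kg)).
by move=> /(_ _)/(congr1 sval); apply; apply/asboolP.
Qed.

(** Over [U], what remains of [g x] lies in [V] exactly when [g x] lies in the union of [V] and [W];
    elsewhere nothing is removed. *)
Lemma usco_remove_open g (U : set X) (W : set Y) :
  usco g -> open U -> open W -> (forall x, U x -> ~ g x `<=` W) ->
  usco (fun x => g x `\` [set y | U x /\ W y]).
Proof.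
move=> [gx guU] oU oW nW; split=> [x|V oV].
  have [g0 cg] := gx x; have [Ux|nUx] := pselect (U x).
    have -> : [set y | U x /\ W y] = W by apply/seteqP; split=> y // [].
    split; last by rewrite setDE; apply: compact_closedI => //; exact: open_closedC.
    by apply/set0P/negP => /eqP; rewrite setD_eq0; exact: nW.
  have -> : [set y | U x /\ W y] = set0 by apply/seteqP; split=> y // [].
  by rewrite setD0.
rewrite (_ : mkset _ = ([set x | g x `<=` V `|` W] `&` U) `|`
    [set x | g x `<=` V]).
  apply: openU; last exact: guU.
  by apply: openI => //; apply: guU; exact: openU.
apply/seteqP; split=> x /=.
  move=> gV; have [Ux|nUx] := pselect (U x); [left|right].
    split=> // y gy; have [Wy|nWy] := pselect (W y); [by right|left].
    by apply: gV; split=> // -[].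
  by move=> y gy; apply: gV; split=> // -[].
move=> [[gVW Ux] y [/gVW[]//Wy []]|gV y [/gV]] //.
Qed.

(** Normality of [Y] separates the parts of [g x] and [h x] outside [U] by disjoint open sets. Near
    [x] each value stays in [U] or its own open set, so common points lie in [U]. *)
Lemma usco_setI g h : hausdorff_space Y ->
  (forall A B : set Y, closed A -> closed B -> A `&` B = set0 ->
    exists U V, [/\ open U, open V, A `<=` U, B `<=` V & U `&` V = set0]) ->
  usco g -> usco h -> (forall x, g x `&` h x !=set0) ->
  usco (fun x => g x `&` h x).
Proof.
move=> hY nY [gx gU] [hx hU] gh0; split=> [x|U oU].
  split=> //; apply: compact_closedI; first exact: (gx x).2.
  exact: compact_closed (hx x).2.
rewrite openE => x /= ghU.
have [|||A [B [oA oB gA hB AB0]]] := nY (g x `\` U) (h x `\` U).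
- rewrite setDE; apply: closedI; last exact: open_closedC.
  exact: compact_closed (gx x).2.
- rewrite setDE; apply: closedI; last exact: open_closedC.
  exact: compact_closed (hx x).2.
- by apply/seteqP; split=> y // [[gy nUy] [hy _]]; apply: nUy; exact: ghU.
have UC (C D : set Y) : C `\` U `<=` D -> C `<=` U `|` D.
  move=> CD y Cy; have [Uy|nUy] := pselect (U y); [by left|right].
  exact: CD.
have := gU _ (openU oU oA); rewrite openE => /(_ x (UC _ _ gA)) nA.
have := hU _ (openU oU oB); rewrite openE => /(_ x (UC _ _ hB)) nB.
apply: filterS (filterI nA nB) => z [/= gUA hUB] y [/gUA[//|Ay] /hUB[//|By]].
by have : (A `&` B) y by []; rewrite AB0.
Qed.

(* Otherwise [W] could be removed from the values of [g] over an open set, and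
   a minimal usco map below what remains would differ from [f]. *)
Lemma unique_minimal_usco_dense g f (W : set Y) (U : set X) x :
  hausdorff_space Y -> usco g ->
  (forall h, minimal_usco h -> Defs.map_subset h g -> h = f) ->
  open W -> open U -> U x -> f x `&` W !=set0 ->
  exists2 z, U z & g z `<=` W.
Proof.
move=> hY ug uniq oW oU Ux [y [fy Wy]]; apply: contrapT => nW.
have uh : usco (fun x => g x `\` [set y | U x /\ W y]).
  by apply: usco_remove_open => // z Uz gzW; apply: nW; exists z.
have [h mh hsub] := minimal_usco_exists _ hY uh.
have hf : h = f by apply: uniq => // z t /hsub[].
by have [_] := hsub x y (eq_ind_r (fun k => k x y) fy hf); apply.
Qed.

Lemma open_dense_setC_nowhere_dense (A : set X) :
  open A -> dense A -> nowhere_dense (~` A).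
Proof.
move=> oA dA; rewrite /nowhere_dense closure_setC ((interior_id A).1 oA).
apply: contrapT => /eqP/set0P/dA => /(_ (@open_interior _ _)) [x [+ Ax]].
by move/interior_subset.
Qed.

End usco_maps.

Theorem theorem20 (R : realType) (X : topologicalType) (Y : metricType R)
    (F : set_system (min_usco X Y)) (f : min_usco X Y) :
  baire_space X -> ProperFilter F -> usco_cvg F f ->
  exists D : set X, residual D /\
    forall x, D x ->
      exists y : Y, sval f x = [set y] /\ filter_at F x --> y.
Proof.
move=> _ FF [G0 capG].
set G := [set g : X -> set Y | usco g /\ F (min_below g)] in G0 capG.
have hY : hausdorff_space Y := @metric_hausdorff R Y.
have fG g : G g -> Defs.map_subset (sval f) g.
  by have : [set f] f by []; rewrite capG; exact.
have uG : G `<=` @usco X Y by move=> g [].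
have [[uf0 uf] _] := svalP f.
(* Pointwise intersections stay in [G]: [f] keeps them nonempty, metric spaces are normal, and a
   minimal map below both [g] and [h] is below their intersection. *)
have dG : down_directed G.
  move=> g h [ug Fg] [uh Fh]; exists (fun x => g x `&` h x); last first.
    by split=> x y [].
  split.
    apply: usco_setI => //; first exact/(@normal_openP R)/pseudometric_normal.
    move=> x; have [[y fy] _] := uf0 x; exists y.
    by split; [apply: (fG g)|apply: (fG h)].
  apply: filterS (filterI Fg Fh) => k [kg kh] x y ky.
  by split; [exact: kg|exact: kh].
pose p x := \bigcap_(g in G) g x.
have up : usco p by exact: usco_bigcap.
have fp : Defs.map_subset (sval f) p by move=> x y fy g /fG; exact.
have uniq h : minimal_usco h -> Defs.map_subset h p -> h = sval f.
  move=> mh hp; suff : [set f] (exist _ h mh) by move=> /(congr1 sval).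
  by rewrite capG => g Gg x y /hp; exact.
pose A n := \bigcup_(y in [set: Y])
  [set x | p x `<=` (ball y n.+1%:R^-1%R)°].
exists (\bigcap_n A n); split.
  exists (fun n => ~` A n); split; last by rewrite setC_bigcap.
  move=> n; apply: open_dense_setC_nowhere_dense.
    by apply: bigcup_open => y _; apply: up.2; exact: open_interior.
  move=> U [x Ux] oU; have [[y fy] _] := uf0 x.
  have [|z Uz pz] := @unique_minimal_usco_dense _ _ p (sval f)
    (ball y n.+1%:R^-1%R)° U x hY up uniq (@open_interior _ _) oU Ux.
    exists y; split=> //.
    by apply: nbhsx_ballx; rewrite invr_gt0 ltr0n.
  by exists z; split=> //; exists y.
move=> x Ax; have [[y fy] _] := uf0 x; exists y.
(* If [y] and [z] were at distance [d > 0], a ball of radius less than [d/2] containing [p x] would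
   force their distance below [d]. *)
have py z : p x z -> z = y.
  move=> pz; apply/esym/eqP; apply: contrapT => /negP; rewrite -mdist_gt0 => yz.
  have [n _ /(_ n (leqnn n)) nyz] :=
    @near_infty_natSinv_lt R (PosNum (divr_gt0 yz (ltr0n R 2))).
  have [w _ pw] := Ax n I.
  have := ball_triangle (ball_sym (interior_subset (pw _ (fp _ _ fy))))
    (interior_subset (pw _ pz)).
  rewrite ballEmdist /= => lt_yz; have := lt_trans lt_yz (ltrD nyz nyz).
  by rewrite /= -splitr ltxx.
have pxy : p x = [set y].
  apply/seteqP; split=> [z /py//|z ->]; exact: fp.
split; first by apply/seteqP; split=> [z /fp/py//|z ->].
(* Some [g] in [G] has [g x] inside [U]; then [min_below g] is a member of [F] whose values at [x]
   all lie in [g x]. *)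
move=> B; rewrite nbhsE => -[U [oU Uy] UB].
have [|g Gg gU] := usco_bigcap_sub _ x _ hY G0 uG dG oU.
  by rewrite -/(p x) pxy => z ->.
exists (min_below g); first by case: Gg.
by move=> z [h hg hz]; apply/UB/gU/hg.
Qed.
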